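(* Let $A$ be a metric space, and let $\Sigma$ and $\Gamma$ be sets of equations (finite or infinite) in any similarity types. If $\Gamma$ is interpretable in $\Sigma$, then $\lambda_A(\Gamma)\le\lambda_A(\Sigma)$.
   Context: Equations and $\lambda$. A similarity type is a family of operation symbols $F_t$ ($t\in T$) of finite arities $n(t)\ge0$; terms are built from variables and these symbols; an equation $\sigma\approx\tau$ is an ordered pair of terms. An algebra $\mathbf A=(A;\overline F_t)_{t\in T}$ has operations $\overline F_t:A^{n(t)}\to A$; each term $\sigma$ yields a term operation $\sigma^{\mathbf A}:A^\omega\to A$. For a nonempty metric space $(A,d)$ put $\lambda_{\mathbf A}(\Sigma)=\sup\{d(\sigma^{\mathbf A}(\mathbf a),\tau^{\mathbf A}(\mathbf a)):\sigma\approx\tau\in\Sigma,\ \mathbf a\in A^\omega\}\in[0,\infty]$ (sup of the empty set is $0$), and $\lambda_A(\Sigma)=\inf\lambda_{\mathbf A}(\Sigma)$ over all algebras $\mathbf A$ on $A$ (of the type of $\Sigma$) whose operations are continuous. Interpretability (strict form). Let $F_t$ ($t\in T$) be the operation symbols of $\Gamma$. Given terms $\alpha_t=\alpha_t(x_1,\dots,x_{n(t)})$ ($t\in T$) in the language of $\Sigma$, define for each term $\sigma$ in the language of $\Gamma$ a term $\sigma^\star$ in the language of $\Sigma$ by $x^\star=x$ for variables $x$, and $F_t(\tau_1,\dots,\tau_{n(t)})^\star=\alpha_t(\tau_1^\star,\dots,\tau_{n(t)}^\star)$ (simultaneous substitution). $\Gamma$ is interpretable in $\Sigma$ if there exist such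 terms $\alpha_t$ with $\sigma^\star\approx\tau^\star$ a member of $\Sigma$ for every $\sigma\approx\tau\in\Gamma$ (membership in $\Sigma$ itself, not merely provability from $\Sigma$). *)

(* Defs.v *)
From HB Require Import structures.
From mathcomp Require Import all_boot all_order all_algebra.
From mathcomp Require Import all_classical all_reals all_analysis.

Set Implicit Arguments.
Unset Strict Implicit.
Unset Printing Implicit Defensive.

Import Order.TTheory GRing.Theory Num.Theory.

Local Open Scope classical_set_scope.
Local Open Scope ring_scope.

Record similarity_type := SimilarityType {
  symbol : Type;
  arity : symbol -> nat
}.

Inductive term (S : similarity_type) (V : Type) : Type :=
| Var of V
| App (t : symbol S) of ('I_(arity t) -> term S V).

Arguments Var {S V} _.
Arguments App {S V} t _.

Fixpoint subst (S : similarity_type) (V W : Type) (s : term S V)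
    (f : V -> term S W) : term S W :=
  match s with
  | Var x => f x
  | App t args => App t (fun i => subst (args i) f)
  end.

(* An equation is an ordered pair of terms in the variables x_0, x_1, ... *)
Definition equation (S : similarity_type) : Type :=
  (term S nat * term S nat)%type.

Definition algebra (S : similarity_type) (A : Type) : Type :=
  forall t : symbol S, ('I_(arity t) -> A) -> A.

Fixpoint term_op (S : similarity_type) (V A : Type) (F : algebra S A)
    (s : term S V) (a : V -> A) : A :=
  match s with
  | Var x => a x
  | App t args => F t (fun i => term_op F (args i) a)
  end.

Definition continuous_algebra (S : similarity_type) (A : topologicalType)
    (F : algebra S A) : Prop :=
  forall t : symbol S, continuous (F t : {ptws 'I_(arity t) -> A} -> A).

(* The element 0 is adjoined because suprema are taken in [0, +oo], whereas
   ereal_sup set0 = -oo; all the other elements are nonnegative. *)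
Definition lambda_algebra (R : realType) (A : metricType R)
    (S : similarity_type) (F : algebra S A) (Sigma : set (equation S)) : \bar R :=
  ereal_sup ([set 0%E] `|`
    [set r | exists (e : equation S) (a : nat -> A),
       Sigma e /\ r = (mdist (term_op F e.1 a) (term_op F e.2 a))%:E]).

Definition lambda (R : realType) (A : metricType R)
    (S : similarity_type) (Sigma : set (equation S)) : \bar R :=
  ereal_inf [set lambda_algebra F Sigma
            | F in [set F : algebra S A | continuous_algebra F]].

(* alpha t is a term in the variables x_1, ..., x_n(t) only, hence the variable
   type 'I_(arity t); in particular alpha t is closed when t is nullary. *)
Fixpoint translate (G S : similarity_type) (V : Type)
    (alpha : forall t : symbol G, term S 'I_(arity t)) (s : term G V) :
    term S V :=
  match s with
  | Var x => Var x
  | App t args => subst (alpha t) (fun i => translate alpha (args i))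
  end.

(* Strict interpretability: translated equations are members of Sigma itself,
   not merely consequences of it. *)
Definition interpretable (G S : similarity_type)
    (Gamma : set (equation G)) (Sigma : set (equation S)) : Prop :=
  exists alpha : forall t : symbol G, term S 'I_(arity t),
    forall s t : term G nat,
      Gamma (s, t) -> Sigma (translate alpha s, translate alpha t).

(* Main.v *)
(* Interpreting each symbol F_t by the term operation of alpha_t turns a
   continuous Sigma-type algebra into a continuous Gamma-type algebra in which
   every term sigma computes what sigma^* computes in the original algebra; so
   the distances measured for Gamma are among those measured for Sigma. *)
Require Import Defs.
From mathcomp Require Import all_boot all_order all_algebra.
From mathcomp Require Import all_classical all_reals all_analysis.

Local Open Scope classical_set_scope.

(* Unlike the library's [pointwise_cvgP], this needs no topology on the index
   type and no uniform structure on the codomain. *)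
Lemma ptws_cvgP (I : Type) (A : topologicalType) (F : set_system (I -> A))
    (f : I -> A) : Filter F ->
  {ptws, F --> f} <-> forall i, g i @[g --> F] --> f i.
Proof.
move=> FF; have surj i : (fun g : I -> A => g i) @` setT = setT.
  by apply/seteqP; split=> // y _; exists (fun=> y).
(* The pointwise topology is the supremum of the topologies induced by the evaluations at each [i];
   as these are surjective, [cvg_image] reduces convergence there to that of the filter of
   images. *)
rewrite cvg_sup; split=> Ff i.
  move: (Ff i) => /cvg_image -/(_ (surj i)); apply: cvg_trans => _ [W FW <-].
  by rewrite nbhs_filterE fmapE; apply: filterS FW; exact: preimage_image.
apply/(cvg_image _ FF (surj i)); apply: cvg_trans (Ff i) => W FW.
by exists ((fun g => g i) @^-1` W) => //; rewrite image_preimage.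
Qed.

Lemma term_op_continuous (S : similarity_type) (V : Type) (A : topologicalType)
    (F : algebra S A) (s : term S V) :
  continuous_algebra F -> continuous (term_op F s : {ptws V -> A} -> A).
Proof.
move=> Fc; elim: s => [x|t args IH] a /=;
  have Fa : Filter (nbhs (a : {ptws V -> A})) := nbhs_filter _.
  (* The neighbourhood filter of [a] converges to [a], hence so does each coordinate. *)
  by have [+ _] := ptws_cvgP V A _ a Fa; apply.
apply: (continuous_comp _ (Fc t _)).
(* The tuple of arguments converges coordinatewise, by induction on subterms. *)
apply/(ptws_cvgP _ _ _ _ (fmap_filter _ Fa)) => i; exact: IH.
Qed.

Lemma term_op_subst (S : similarity_type) (V W A : Type) (F : algebra S A)
    (s : term S V) (f : V -> term S W) (a : W -> A) :
  term_op F (subst s f) a = term_op F s (fun x => term_op F (f x) a).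
Proof.
by elim: s => //= t args IH; congr (F t _); apply/funext => i; exact: IH.
Qed.

Definition reduct {G S : similarity_type} {A : Type}
    (alpha : forall t : symbol G, term S 'I_(arity t)) (F : algebra S A) :
  algebra G A := fun t => term_op F (alpha t).

Lemma term_op_translate (G S : similarity_type) (V A : Type)
    (alpha : forall t : symbol G, term S 'I_(arity t)) (F : algebra S A)
    (s : term G V) (a : V -> A) :
  term_op F (translate alpha s) a = term_op (reduct alpha F) s a.
Proof.
elim: s => //= t args IH; rewrite term_op_subst /reduct.
by congr (term_op F _ _); apply/funext => i; exact: IH.
Qed.

Theorem theorem1 (R : realType) (A : metricType R)
  (hA : [set: A] !=set0)
  (S G : similarity_type)
  (Sigma : set (equation S)) (Gamma : set (equation G))
  (hinterp : interpretable Gamma Sigma) :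
  (lambda A Gamma <= lambda A Sigma)%E.
Proof.
have [alpha halpha] := hinterp.
apply: le_ereal_inf_tmp => _ [F Fc <-].
have Rc : continuous_algebra (reduct alpha F).
  by move=> t; exact: term_op_continuous.
apply: (@Order.POrderTheory.le_trans _ _
  (lambda_algebra (reduct alpha F) Gamma)).
  (* The reduct competes in the infimum for [Gamma]. *)
  by apply: ereal_inf_lbound; exists (reduct alpha F).
(* Inclusion of the sets of values suffices: both contain the adjoined 0, and the translated
   equation at the same [a] gives the same distance. *)
apply: ereal_sup_le => r [->|[[s t] [a [Gst ->]]]]; first by left.
right; exists (translate alpha s, translate alpha t), a.
by split; [exact: halpha|rewrite /= !term_op_translate].
Qed.
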